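(* Let $K_1\in\mathcal{B}(H)$, $K_2\in\mathcal{B}(X)$, $T,T_1\in\mathcal{GB}(H)$ and $U,U_1\in\mathcal{GB}(X)$. Let $\Lambda_{TT_1}=\{(W_j,\Lambda_j,v_j)\}_{j\in J}$ be a $(T,T_1)$-controlled $K_1$-$g$-fusion frame for $H$ with bounds $A,B$, and let $\Gamma_{UU_1}=\{(V_j,\Gamma_j,v_j)\}_{j\in J}$ be a $(U,U_1)$-controlled $K_2$-$g$-fusion frame for $X$ with bounds $C,D$. Then $$\Lambda_{TT_1}\oplus\Gamma_{UU_1}=\{(W_j\oplus V_j,\ \Lambda_j\oplus\Gamma_j,\ v_j)\}_{j\in J}$$ is a $(T\oplus U,\ T_1\oplus U_1)$-controlled $K_1\oplus K_2$-$g$-fusion frame for $H\oplus X$ with bounds $\min\{A,C\}$ and $\max\{B,D\}$. Furthermore, if $S_C$, $S_{C'}$ and $S$ are the frame operators of $\Lambda_{TT_1}$, $\Gamma_{UU_1}$ and $\Lambda_{TT_1}\oplus\Gamma_{UU_1}$, respectively, then $S=S_C\oplus S_{C'}$.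
   Context: $H$ and $X$ are separable Hilbert spaces, $J\subset\mathbb{Z}$, $\{H_j\}_{j\in J}$ and $\{X_j\}_{j\in J}$ are collections of Hilbert spaces, $W_j\subset H$ and $V_j\subset X$ are closed subspaces, $v_j>0$ are weights, $\Lambda_j\in\mathcal{B}(H,H_j)$ and $\Gamma_j\in\mathcal{B}(X,X_j)$. $\mathcal{B}$ denotes bounded linear operators and $\mathcal{GB}(H)$ the operators in $\mathcal{B}(H)$ having a bounded inverse. $P_M$ is the orthogonal projection onto a closed subspace $M$. $H\oplus X=\{f\oplus g=(f,g): f\in H, g\in X\}$ is the Hilbert space with inner product $\langle f\oplus g,f'\oplus g'\rangle=\langle f,f'\rangle_H+\langle g,g'\rangle_X$ and the norm it induces. For $R\in\mathcal{B}(H,Z)$ and $V\in\mathcal{B}(X,Y)$ ($Z,Y$ Hilbert spaces), $R\oplus V\in\mathcal{B}(H\oplus X,Z\oplus Y)$ is $(R\oplus V)(f\oplus g)=(Rf,Vg)$; in particular $\Lambda_j\oplus\Gamma_j\in\mathcal{B}(H\oplus X,H_j\oplus X_j)$. For a Hilbert space $E$, $K\in\mathcal{B}(E)$, and $R,R'\in\mathcal{GB}(E)$, a family $\{(M_j,\Theta_j,v_j)\}_{j\in J}$ ($M_j\subset E$ closed subspaces, $\Theta_j$ bounded operators from $E$ to Hilbert spaces, $v_j>0$) is an $(R,R')$-controlled $K$-$g$-fusion frame for $E$ with bounds $a,b$ if $0<a\le b<\infty$ and $$a\|K^*e\|^2\le\sum_{j\in J}v_j^2\langle\Theta_jP_{M_j}R'e,\Theta_jP_{M_j}Re\rangle\le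 b\|e\|^2\quad\text{for all } e\in E.$$ Its frame operator is $e\mapsto\sum_{j\in J}v_j^2R^*P_{M_j}\Theta_j^*\Theta_jP_{M_j}R'e$. *)

(* Defs.v *)
From HB Require Import structures.
From mathcomp Require Import all_boot all_order all_algebra sesquilinear.
From mathcomp Require Import complex ring lra.
From mathcomp Require Import all_classical all_reals all_analysis.
From mathcomp.analysis.showcase Require summability.

Set Implicit Arguments.
Unset Strict Implicit.
Unset Printing Implicit Defensive.

Import Order.TTheory GRing.Theory Num.Theory.
Import numFieldNormedType.Exports.
Local Open Scope classical_set_scope.
Local Open Scope ring_scope.

(* Hilbert spaces are taken over the real or the complex field; results are
   stated uniformly in [k : scalar_kind].  On [R[i]] the library order is
   [x <= y <-> Im x = Im y /\ Re x <= Re y], so a comparison between a real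
   number and a scalar [s] also says that [s] is real. *)
Variant scalar_kind := RealScalars | ComplexScalars.

Definition scalar (R : realType) (k : scalar_kind) : numFieldType :=
  match k with RealScalars => R | ComplexScalars => R[i] end.

Definition of_real (R : realType) (k : scalar_kind) : R -> scalar R k :=
  match k with
  | RealScalars => fun x => x
  | ComplexScalars => real_complex R
  end.

Definition real_part (R : realType) (k : scalar_kind) : scalar R k -> R :=
  match k with RealScalars => fun x => x | ComplexScalars => @complex.Re R end.

Definition sconj (R : realType) (k : scalar_kind) : scalar R k -> scalar R k :=
  match k with
  | RealScalars => fun x => x
  | ComplexScalars => @conjc R
  end.
Arguments of_real {R k}.
Arguments real_part {R k}.
Arguments sconj {R k}.

(* The inner product is linear in its first argument and conjugate-linear in
   the second one. *)
HB.mixin Record isHilbert (R : realType) (k : scalar_kind) H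
    of CompleteNormedModule (scalar R k) H := {
  inner : {dot H for @sconj R k} ;
  inner_norm : forall x : H, inner x x = `|x| ^+ 2
}.

#[short(type="hilbertType")]
HB.structure Definition Hilbert (R : realType) (k : scalar_kind) :=
  {H of CompleteNormedModule (scalar R k) H & isHilbert R k H}.

Section ScalarTheory.
Variables (R : realType) (k : scalar_kind).
Local Notation K := (scalar R k).
Implicit Types (a b : R) (x y : K).

Lemma of_realD a b : of_real (a + b) = of_real a + of_real b :> K.
Proof. by case: k => //=; rewrite rmorphD. Qed.

Lemma of_realM a b : of_real (a * b) = of_real a * of_real b :> K.
Proof. by case: k => //=; rewrite rmorphM. Qed.

Lemma of_real0 : of_real 0 = 0 :> K.
Proof. by case: k. Qed.

Lemma of_real_le a b : ((of_real a : K) <= of_real b) = (a <= b).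
Proof. by case: k => //=; rewrite lecR. Qed.

Lemma of_realK a : real_part (of_real a : K) = a.
Proof. by case: k. Qed.

Lemma real_partK x : 0 <= x -> of_real (real_part x) = x.
Proof.
case: k x => //= x; rewrite lecE => /andP[/eqP /= x0 _].
by apply/eqP; rewrite eq_complex /= x0 !eqxx.
Qed.

Lemma sconjD x y : sconj (x + y) = sconj x + sconj y.
Proof. by case: k x y => //= x y; rewrite rmorphD. Qed.

End ScalarTheory.

(* The library norm on a product [H * X] is the sup norm; [hsum H X] carries
   the norm of the inner product [<f, f'> + <g, g'>]. *)
Definition hsum (R : realType) (k : scalar_kind) (H X : hilbertType R k) : Type :=
  (H * X)%type.

Section DirectSum.
Variables (R : realType) (k : scalar_kind) (H X : hilbertType R k).
Local Notation K := (scalar R k).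
Local Notation E := (hsum H X).

HB.instance Definition _ := GRing.Lmodule.copy E (H * X)%type.

Definition hsum_inner (p q : E) : K := inner p.1 q.1 + inner p.2 q.2.

Let nR (T : hilbertType R k) (x : T) : R := real_part `|x|.

Let nRE (T : hilbertType R k) (x : T) : of_real (nR x) = `|x| :> K.
Proof. exact: real_partK. Qed.

Let nR_ge0 (T : hilbertType R k) (x : T) : 0 <= nR x.
Proof. by rewrite -(of_real_le k) nRE of_real0. Qed.

Definition hsum_normR (p : E) : R := Num.sqrt (nR p.1 ^+ 2 + nR p.2 ^+ 2).

Definition hsum_norm (p : E) : K := of_real (hsum_normR p).

Let l2_triangle (a b c d : R) :
  Num.sqrt ((a + c) ^+ 2 + (b + d) ^+ 2) <=
  Num.sqrt (a ^+ 2 + b ^+ 2) + Num.sqrt (c ^+ 2 + d ^+ 2).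
Proof.
have s0 (u v : R) : 0 <= u ^+ 2 + v ^+ 2 by rewrite addr_ge0 ?sqr_ge0.
have := sqr_sqrtr (s0 a b); have := sqr_sqrtr (s0 c d).
have := sqrtr_ge0 (a ^+ 2 + b ^+ 2); have := sqrtr_ge0 (c ^+ 2 + d ^+ 2).
move: (Num.sqrt (a ^+ 2 + b ^+ 2)) (Num.sqrt (c ^+ 2 + d ^+ 2)) => p q q0 p0 qE pE.
rewrite -[leRHS](ger0_norm (addr_ge0 p0 q0)) -sqrtr_sqr ler_wsqrtr//.
have pq0 : 0 <= p * q by exact: mulr_ge0.
suff : a * c + b * d <= p * q by nra.
apply: (le_trans (ler_norm _)).
rewrite -(ger0_norm pq0) -ler_sqr ?nnegrE ?normr_ge0// !real_normK ?num_real//.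
rewrite exprMn qE pE -subr_ge0.
rewrite (_ : _ - _ = (a * d - b * c) ^+ 2) ?sqr_ge0//; ring.
Qed.

Let l2_le (a b : R) : 0 <= a -> 0 <= b -> Num.sqrt (a ^+ 2 + b ^+ 2) <= a + b.
Proof.
move=> a0 b0; have ab0 := addr_ge0 a0 b0.
rewrite -[leRHS](ger0_norm ab0) -sqrtr_sqr ler_wsqrtr//.
by have := mulr_ge0 a0 b0; nra.
Qed.

Lemma hsum_norm_ler (p q : E) : hsum_norm (p + q) <= hsum_norm p + hsum_norm q.
Proof.
rewrite -of_realD of_real_le; apply: le_trans (l2_triangle _ _ _ _).
have nRD (T : hilbertType R k) (x y : T) : nR (x + y) <= nR x + nR y.
  by rewrite -(of_real_le k) of_realD !nRE ler_normD.
by rewrite ler_wsqrtr// lerD// ler_sqr ?nnegrE ?addr_ge0 ?nR_ge0 ?nRD.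
Qed.

Lemma hsum_normZ (l : K) (p : E) : hsum_norm (l *: p) = `|l| * hsum_norm p.
Proof.
pose r := real_part `|l|; have rE : of_real r = `|l| by exact: real_partK.
have r0 : 0 <= r by rewrite -(of_real_le k) rE of_real0.
have nRZ (T : hilbertType R k) (x : T) : nR (l *: x) = r * nR x.
  by rewrite -[LHS](of_realK k) nRE normrZ -rE -nRE -of_realM of_realK.
rewrite -rE -of_realM; congr of_real.
rewrite /hsum_normR /= !nRZ !exprMn -mulrDr sqrtrM ?sqr_ge0//.
by rewrite sqrtr_sqr ger0_norm.
Qed.

Let nR_le1 (p : E) : `|p.1| <= hsum_norm p.
Proof.
rewrite -nRE of_real_le -[leLHS](ger0_norm (nR_ge0 _)) -sqrtr_sqr ler_wsqrtr//.
by rewrite lerDl sqr_ge0.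
Qed.

Let nR_le2 (p : E) : `|p.2| <= hsum_norm p.
Proof.
rewrite -nRE of_real_le -[leLHS](ger0_norm (nR_ge0 _)) -sqrtr_sqr ler_wsqrtr//.
by rewrite lerDr sqr_ge0.
Qed.

Let hsum_norm_le (p : E) : hsum_norm p <= `|p.1| + `|p.2|.
Proof. by rewrite -!nRE -of_realD of_real_le l2_le. Qed.

Lemma hsum_norm0_eq0 (p : E) : hsum_norm p = 0 -> p = 0.
Proof.
move=> p0; have := nR_le1 p; have := nR_le2 p; rewrite p0 !normr_le0.
by move=> /eqP p2 /eqP p1; rewrite [p]surjective_pairing p1 p2.
Qed.

HB.instance Definition _ := Lmodule_isNormed.Build K E
  hsum_norm_ler hsum_normZ hsum_norm0_eq0.

Lemma hsum_complete (F : set_system E) : ProperFilter F -> cauchy F -> cvg F.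
Proof.
move=> FF /cauchy_ballP Fc.
have c1 : cauchy ((fst : E -> H) @ F).
  apply/cauchy_ballP => e e0; have [[A B] /= [FA FB] AB] := Fc e e0.
  exists (fst @` A, fst @` B) => /=.
    by split; [apply: filterS FA | apply: filterS FB] => p ?; exists p.
  move=> [_ _] /= [[p Ap <-] [q Bq <-]].
  have := AB (p, q) (conj Ap Bq); rewrite -!ball_normE /= => pq.
  by apply: le_lt_trans pq; exact: (nR_le1 (p - q)).
have c2 : cauchy ((snd : E -> X) @ F).
  apply/cauchy_ballP => e e0; have [[A B] /= [FA FB] AB] := Fc e e0.
  exists (snd @` A, snd @` B) => /=.
    by split; [apply: filterS FA | apply: filterS FB] => p ?; exists p.
  move=> [_ _] /= [[p Ap <-] [q Bq <-]].
  have := AB (p, q) (conj Ap Bq); rewrite -!ball_normE /= => pq.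
  by apply: le_lt_trans pq; exact: (nR_le2 (p - q)).
have /cvg_ex[l1 /cvgrPdist_lt l1P] : cvg ((fst : E -> H) @ F).
  exact: cauchy_cvg c1.
have /cvg_ex[l2 /cvgrPdist_lt l2P] : cvg ((snd : E -> X) @ F).
  exact: cauchy_cvg c2.
pose l : E := (l1, l2).
have : F --> l; last by move=> Fl; apply/cvg_ex; exists l.
apply/cvgrPdist_lt => e e0.
have e20 : 0 < e / 2 by rewrite divr_gt0.
apply: (@filterS _ F _ _ _ _ (filterI (l1P _ e20) (l2P _ e20))) => p [/= p1 p2].
rewrite (splitr e); apply: le_lt_trans (ltrD p1 p2).
exact: (hsum_norm_le (l - p)).
Qed.



HB.instance Definition _ := Uniform_isComplete.Build E hsum_complete.

Let hsum_innerBl q : zmod_morphism (hsum_inner^~ q).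
Proof. by move=> x y; rewrite /hsum_inner /= !linearBl opprD addrACA. Qed.

Let hsum_innerBr p : zmod_morphism (hsum_inner p).
Proof. by move=> x y; rewrite /hsum_inner /= !linearBr opprD addrACA. Qed.

Let hsum_innerZl q : scalable_for *%R (hsum_inner^~ q).
Proof. by move=> a x; rewrite /hsum_inner /= !linearZl_LR mulrDr. Qed.

Let hsum_innerZr p : scalable_for (sconj \; *%R) (hsum_inner p).
Proof. by move=> a x; rewrite /hsum_inner /= !linearZr_LR /= mulrDr. Qed.

HB.instance Definition _ := isBilinear.Build K E E K *%R (sconj \; *%R)
  hsum_inner hsum_innerBl hsum_innerBr hsum_innerZl hsum_innerZr.

Let hsum_innerC p q :
  hsum_inner p q = (-1) ^+ false * sconj (hsum_inner q p).
Proof.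
rewrite expr0 mul1r /hsum_inner sconjD.
by congr (_ + _); rewrite [LHS]hermitian_subproof expr0 mul1r.
Qed.

HB.instance Definition _ := isHermitianSesquilinear.Build K E false sconj
  hsum_inner hsum_innerC.

Let hsum_inner_norm p : hsum_inner p p = `|p| ^+ 2.
Proof.
rewrite (_ : `|p| = hsum_norm p)//.
rewrite /hsum_inner !inner_norm -!nRE !expr2 -!of_realM -of_realD.
by rewrite -!expr2 sqr_sqrtr// addr_ge0 ?sqr_ge0.
Qed.

Let hsum_inner_gt0 p : p != 0 -> 0 < hsum_inner p p.
Proof. by move=> p0; rewrite hsum_inner_norm exprn_gt0// normr_gt0. Qed.

HB.instance Definition _ := isDotProduct.Build K E hsum_inner hsum_inner_gt0.

HB.instance Definition _ := isHilbert.Build R k E hsum_inner_norm.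

End DirectSum.

Section DirectSumTheory.
Variables (R : realType) (k : scalar_kind) (H X : hilbertType R k).

Lemma hsum_innerE (p q : hsum H X) :
  inner p q = inner p.1 q.1 + inner p.2 q.2.
Proof. by []. Qed.

Lemma hsum_normE (p : hsum H X) :
  `|p| ^+ 2 = `|p.1| ^+ 2 + `|p.2| ^+ 2 :> scalar R k.
Proof. by rewrite -!inner_norm. Qed.

End DirectSumTheory.

Definition opsum (R : realType) (k : scalar_kind) (H X Z Y : hilbertType R k)
    (f : H -> Z) (g : X -> Y) : hsum H X -> hsum Z Y :=
  fun p => (f p.1, g p.2).

Definition subsum (R : realType) (k : scalar_kind) (H X : hilbertType R k)
    (W : set H) (V : set X) : set (hsum H X) := W `*` V.

Definition separable (T : topologicalType) :=
  exists2 D : set T, countable D & dense D.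

Section Operators.
Variables (R : realType) (k : scalar_kind).
Implicit Types E F : hilbertType R k.

Definition bounded_op E F (f : E -> F) :=
  linear f /\ exists c : R, forall x, `|f x| <= of_real c * `|x|.

Definition invertible_op E (f : E -> E) :=
  bounded_op f /\ exists g : E -> E, [/\ bounded_op g, cancel f g & cancel g f].

Definition closed_subspace E (M : set E) :=
  [/\ M 0, (forall (a : scalar R k) x y, M x -> M y -> M (a *: x + y)) & closed M].

(* [xget 0 A] is some element of [A], or [0] if [A] is empty.  The sets below
   have at most one element; they have exactly one, for all [x] and [y], when
   [M] is a closed subspace and [f] is a bounded operator (projection theorem
   and Riesz representation theorem). *)
Definition proj E (M : set E) (x : E) : E :=
  xget 0 [set y | M y /\ forall z, M z -> inner (x - y) z = 0].

Definition adjoint E F (f : E -> F) (y : F) : E :=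
  xget 0 [set z | forall x, inner (f x) y = inner x z].

End Operators.

(* Unconditional convergence: the sums over the finite subsets of [I], directed
   by inclusion, converge to [s]. *)
Definition sums_to (K : numFieldType) (V : normedModType K) (I : choiceType)
    (x : I -> V) (s : V) :=
  summability.partial_sum x @ summability.totally --> s.

Section GFusion.
Variables (R : realType) (k : scalar_kind) (E : hilbertType R k) (I : choiceType).
Variables (M : I -> set E) (Z : I -> hilbertType R k).
Variables (Theta : forall j, E -> Z j) (v : I -> R).

Definition controlled_gfusion_frame (C C' Kop : E -> E) (a b : R) :=
  [/\ invertible_op C /\ invertible_op C', bounded_op Kop,
      (forall j, [/\ closed_subspace (M j), bounded_op (Theta j) & 0 < v j]),
      0 < a <= b
    & forall e : E, exists s : scalar R k,
        [/\ sums_to (V := (scalar R k)^o) (fun j => of_real (v j ^+ 2) *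
              inner (Theta j (proj (M j) (C' e))) (Theta j (proj (M j) (C e)))) s,
            of_real a * `|adjoint Kop e| ^+ 2 <= s
          & s <= of_real b * `|e| ^+ 2]].

Definition is_frame_operator (C C' : E -> E) (S : E -> E) :=
  forall e : E, sums_to
    (fun j => of_real (v j ^+ 2) *:
      adjoint C (proj (M j) (adjoint (Theta j) (Theta j (proj (M j) (C' e))))))
    (S e).

End GFusion.

(* Main.v *)
Require Import Defs.
From HB Require Import structures.
From mathcomp Require Import all_boot all_order all_algebra sesquilinear.
From mathcomp Require Import complex ring lra.
From mathcomp Require Import all_classical all_reals all_analysis.
From mathcomp.analysis.showcase Require summability.
Import Order.TTheory GRing.Theory Num.Theory.
Import numFieldNormedType.Exports.
Local Open Scope classical_set_scope.
Local Open Scope ring_scope.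

(* The projection theorem and the Riesz representation theorem give the
   existence of [proj] and [adjoint]; since both are unique, those of a direct
   sum are computed componentwise.  The frame series and the frame operator of
   the direct sum then split into the sums of the ones of the two frames. *)

Section HilbertSpace.
Set Implicit Arguments.
Unset Strict Implicit.
Variables (R : realType) (k : scalar_kind).
Local Notation K := (Defs.scalar R k).
Implicit Types (a : K) (E F : hilbertType R k).

(** * Scalar conjugation, inner product identities and Cauchy-Schwarz *)

Lemma sconjK : involutive (sconj : K -> K).
Proof. by case: k => //= x; rewrite conjcK. Qed.

Lemma sconjM (a b : K) : sconj (a * b) = sconj a * sconj b.
Proof. by case: k a b => //= a b; rewrite rmorphM. Qed.

Lemma mul_sconj a : a * sconj a = `|a| ^+ 2.
Proof.
by case: k a => /= a; [rewrite real_normK ?num_real// expr2|rewrite sqr_normc].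
Qed.

Lemma sconj_ge0 a : 0 <= a -> sconj a = a.
Proof.
move=> a0; rewrite -(real_partK a0).
by case: k a a0 => a _ //; exact: conjc_real.
Qed.

Lemma inner_sym E (x y : E) : inner x y = sconj (inner y x).
Proof. by rewrite [LHS]hermitian_subproof expr0 mul1r. Qed.

Lemma sqr_normB E (x y : E) :
  `|x - y| ^+ 2 = `|x| ^+ 2 - inner x y - inner y x + `|y| ^+ 2 :> K.
Proof. by rewrite -!inner_norm linearBl !linearBr /= opprB addrA addrAC. Qed.

Lemma parallelogram E (x y : E) :
  `|x + y| ^+ 2 + `|x - y| ^+ 2 = 2 * (`|x| ^+ 2 + `|y| ^+ 2) :> K.
Proof.
by rewrite -!inner_norm linearBl linearDl !linearBr !linearDr /=; ring.
Qed.

(** Pythagoras: the vector subtracted from [w] is its orthogonal projection onto the line through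
    [z]. Both Cauchy-Schwarz and the orthogonality of a closest point come from this identity. *)
Lemma sqr_norm_sub_line E (w z : E) : z != 0 ->
  `|w - (inner w z / `|z| ^+ 2) *: z| ^+ 2 =
    `|w| ^+ 2 - `|inner w z| ^+ 2 / `|z| ^+ 2 :> K.
Proof.
move=> z0; have n0 : `|z| ^+ 2 != 0 :> K by rewrite sqrf_eq0 normr_eq0.
have sn : sconj (`|z| ^+ 2)^-1 = (`|z| ^+ 2)^-1 :> K.
  by rewrite sconj_ge0// invr_ge0 exprn_ge0.
rewrite sqr_normB normrZ exprMn -!mul_sconj linearZl_LR linearZr_LR /=.
rewrite [inner z w]inner_sym !sconjM sn.
move: (`|w| ^+ 2) (`|z| ^+ 2) (inner w z) n0 => u n c n0; move: (sconj c) => c'.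
by rewrite -[_ * _ * n]mulrA divfK// subrK mulrAC [c' * c]mulrC.
Qed.

(** After squaring and dividing by [|y|^2], the gap between the two sides is the squared norm of [x]
    minus its component along [y]. *)
Lemma cauchy_schwarz E (x y : E) : `|inner x y| <= `|x| * `|y| :> K.
Proof.
have [->|y0] := eqVneq y 0; first by rewrite linear0r !normr0 mulr0.
rewrite -ler_sqr ?nnegrE ?mulr_ge0// exprMn.
rewrite -ler_pdivrMr ?exprn_gt0 ?normr_gt0//.
by rewrite -subr_ge0 -sqr_norm_sub_line// exprn_ge0.
Qed.

(** Removing from [w] its component along [z] lowers the squared norm by [|<w, z>|^2 / |z|^2], so
    minimality forces [<w, z>] to vanish. *)
Lemma closest_orthogonal E (w z : E) :
  (forall a, `|w| <= `|w - a *: z|) -> inner w z = 0.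
Proof.
move=> wmin; have [->|z0] := eqVneq z 0; first by rewrite linear0r.
have := wmin (inner w z / `|z| ^+ 2).
rewrite -ler_sqr ?nnegrE// sqr_norm_sub_line// lerDl oppr_ge0.
rewrite pmulr_lle0 ?invr_gt0 ?exprn_gt0 ?normr_gt0// -normrX normr_le0.
by rewrite sqrf_eq0 => /eqP.
Qed.

(** * Projection theorem, Riesz representation and adjoints *)

Lemma of_real_lt (a b : R) : ((of_real a : K) < of_real b) = (a < b).
Proof. by case: k => //=; rewrite ltcR. Qed.

(** Infima and nonlinear real arithmetic call for values in [R]: complex scalars are only partially
    ordered. *)
Definition rnorm E (x : E) : R := real_part `|x|.

Lemma rnormE E (x : E) : of_real (rnorm x) = `|x| :> K.
Proof. exact: real_partK. Qed.

Lemma rnorm_ge0 E (x : E) : 0 <= rnorm x.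
Proof. by rewrite -(of_real_le k) rnormE of_real0. Qed.

Lemma rnorm_parallelogram E (x y : E) :
  rnorm (x + y) ^+ 2 + rnorm (x - y) ^+ 2 = 2 * (rnorm x ^+ 2 + rnorm y ^+ 2).
Proof.
have sqE z : of_real (rnorm z ^+ 2) = `|z| ^+ 2 :> K.
  by rewrite expr2 [LHS]of_realM rnormE -expr2.
have addE z t :
    of_real (rnorm z ^+ 2 + rnorm t ^+ 2) = `|z| ^+ 2 + `|t| ^+ 2 :> K.
  by rewrite [LHS]of_realD !sqE.
apply: (can_inj (@of_realK R k)).
by rewrite addE parallelogram !mulrDl !mul1r [RHS]of_realD addE.
Qed.

Lemma rnormZ2 E (x : E) : rnorm (2 *: x) = 2 * rnorm x.
Proof.
apply: (can_inj (@of_realK R k)).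
by rewrite rnormE normrZ normr_nat !mulrDl !mul1r [RHS]of_realD rnormE.
Qed.

(** Near-minimizers of the distance from [x] to [M] are close to each other by the parallelogram
    law. Completeness gives a closest point [y], and minimality makes [x - y] orthogonal to [M]. *)
Lemma proj_exists E (M : set E) (x : E) : closed_subspace M ->
  exists y, M y /\ forall z, M z -> inner (x - y) z = 0.
Proof.
move=> [M0 MD Mcl].
pose q (m : E) : R := rnorm (x - m).
pose d := inf (q @` M).
have dlb : has_lbound (q @` M) by exists 0 => _ [m _ <-]; exact: rnorm_ge0.
have dle m : M m -> d <= q m by move=> Mm; apply: ge_inf => //; exists m.
have d0 : 0 <= d.
  by apply: lb_le_inf; [exists (q 0), 0|move=> _ [m _ <-]; exact: rnorm_ge0].
(* The sets of near-minimizers generate a filter, which takes the place of a chosen minimizing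
   sequence. *)
pose near_min (e : R) := [set m | M m /\ q m <= d + e].
pose G := filter_from [set e : R | 0 < e] near_min.
have GF : ProperFilter G.
  apply: filter_from_proper; last first.
    move=> e e0.
    have hi : has_inf (q @` M) by split => //; exists (q 0), 0.
    have [_ [m Mm <-] lt] := inf_adherent e0 hi.
    by exists m; split => //; apply: ltW.
  apply: filter_from_filter; first by exists 1 => /=.
  move=> e e' e0 e'0; exists (Num.min e e'); first by rewrite /= lt_min e0.
  by move=> m [Mm]; rewrite -lerBlDl le_min !lerBlDl => /andP[].
have midM m m' : M m -> M m' -> M (2^-1 *: (m + m')).
  move=> Mm Mm'; rewrite -[_ *: _]addr0; apply: (MD) => //.
  by rewrite -[m]scale1r; apply: MD.
(* The midpoint of [m] and [m'] is in [M], hence at distance [>= d]. *)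
have close e m m' : near_min e m -> near_min e m' ->
    rnorm (m' - m) ^+ 2 <= 8 * d * e + 4 * e ^+ 2.
  move=> [Mm qm] [Mm' qm'].
  have := rnorm_parallelogram (x - m) (x - m').
  have -> : x - m - (x - m') = m' - m by rewrite opprB addrC addrA subrK.
  have -> : x - m + (x - m') = 2 *: (x - 2^-1 *: (m + m')).
    rewrite scalerBr scalerA mulfV ?pnatr_eq0// scale1r scaler_nat mulr2n.
    by rewrite opprD addrACA.
  rewrite rnormZ2; have := dle _ (midM _ _ Mm Mm').
  rewrite /q in qm qm' *; have := rnorm_ge0 (x - m); have := rnorm_ge0 (x - m').
  move: (rnorm (x - m)) (rnorm (x - m')) (rnorm (x - _ *: _)) (rnorm (m' - m))
    qm qm'.
  move=> r r' s t rd r'd r'0 r0 ds eq.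
  (* The parallelogram law reads [4 s^2 + t^2 = 2 (r^2 + r'^2)]. Hence [t^2 <= 4 (d + e)^2 - 4 d^2],
     which is the bound claimed. *)
  have h1 : r ^+ 2 <= (d + e) ^+ 2 by rewrite ler_sqr ?nnegrE// (le_trans r0).
  have h2 : r' ^+ 2 <= (d + e) ^+ 2 by rewrite ler_sqr ?nnegrE// (le_trans r0).
  have h3 : d ^+ 2 <= s ^+ 2 by rewrite ler_sqr ?nnegrE// (le_trans d0).
  by nra.
have Gc : cauchy G.
  apply/cauchy_ballP => e e0.
  have er : of_real (real_part e) = e by rewrite real_partK ?ltW.
  move: er e0; move: (real_part e) => r <- r0.
  have {}r0 : 0 < r by rewrite -of_real_lt of_real0.
  (* As [de <= 1], the bound [8 d de + 4 de^2] is at most [(8 d + 4) de]. The constant 5 instead of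
     4 makes the comparison with [r^2] strict. *)
  pose de := Num.min 1 (r ^+ 2 / (8 * d + 5)).
  have c0 : 0 < 8 * d + 5 by lra.
  have de0 : 0 < de by rewrite lt_min ltr01 divr_gt0// exprn_gt0.
  exists (near_min de, near_min de); first by split; exists de.
  move=> [m m'] /= [mm mm']; rewrite -ball_normE /= -rnormE.
  rewrite of_real_lt -ltr_sqr ?nnegrE ?rnorm_ge0 ?ltW//.
  apply: le_lt_trans (close _ _ _ mm' mm) _.
  have de1 : de <= 1 by rewrite ge_min lexx.
  have : de * (8 * d + 5) <= r ^+ 2.
    by rewrite -ler_pdivlMr// ge_min lexx orbT.
  by nra.
have /cvg_ex[y Gy] : cvg G by exact: cauchy_cvg Gc.
have My : M y.
  have G1 : G (near_min 1) by exists 1 => /=.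
  apply: Mcl => B /Gy GB.
  by have [m [[Mm _] Bm]] := filter_ex (filterI G1 GB); exists m.
have qy : q y <= d.
  (* Half of [e] pays for the near-minimality of some [m], the other half for its distance to
     [y]. *)
  apply/ler_addgt0Pr => e e0; have e20 : 0 < e / 2 by rewrite divr_gt0.
  have e2K : 0 < of_real (e / 2) :> K by rewrite -(of_real0 R k) of_real_lt.
  have Gmin : G (near_min (e / 2)) by exists (e / 2).
  have Gball : G [set m | `|y - m| < of_real (e / 2) :> K].
    by have := Gy _ (nbhsx_ballx y _ e2K); rewrite -ball_normE.
  have [m [[Mm qm] /= ym]] := filter_ex (filterI Gmin Gball).
  have : q y <= q m + rnorm (y - m).
    rewrite -(of_real_le k) of_realD !rnormE.
    by rewrite (_ : x - y = (x - m) - (y - m)) ?ler_normB// opprB addrA subrK.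
  by move: ym qm; rewrite -rnormE of_real_lt; lra.
(* Since [y + a *: z] stays in [M], no multiple of [z] can shorten [x - y]. *)
exists y; split => // z Mz; apply: closest_orthogonal => a.
rewrite -addrA -opprD -!rnormE of_real_le (le_trans qy)// dle// addrC.
exact: MD.
Qed.

Lemma projP E (M : set E) (x : E) : closed_subspace M ->
  M (Defs.proj M x) /\ forall z, M z -> inner (x - Defs.proj M x) z = 0.
Proof.
move=> Msub.
exact: (@xgetPex _ 0 [set y | M y /\ forall z, M z -> inner (x - y) z = 0])
  (proj_exists x Msub).
Qed.

Lemma inner_injr E (y z : E) : (forall x, inner x y = inner x z) -> y = z.
Proof.
move=> yz; apply/eqP; rewrite -subr_eq0 -normr_eq0 -sqrf_eq0 -inner_norm.
by rewrite linearBr /= yz subrr.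
Qed.

(** The difference of two candidates lies in [M] and is also a difference of two residuals
    orthogonal to [M]. It is thus orthogonal to itself. *)
Lemma proj_unique E (M : set E) (x y : E) : closed_subspace M ->
  M y -> (forall z, M z -> inner (x - y) z = 0) -> Defs.proj M x = y.
Proof.
move=> Msub My yP; have [Mp pP] := projP x Msub.
have [_ MD _] := Msub.
have Md : M (y - Defs.proj M x) by rewrite addrC -scaleN1r; exact: MD.
apply/esym/eqP; rewrite -subr_eq0 -normr_eq0 -sqrf_eq0 -inner_norm.
have dE : y - Defs.proj M x = (x - Defs.proj M x) - (x - y).
  by rewrite opprB [RHS]addrC addrA subrK.
by rewrite [X in inner X _]dE linearBl /= pP// yP// subrr.
Qed.

(** If [phi] is not zero, its kernel [N] is a proper closed subspace, and a nonzero vector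
    orthogonal to [N] represents [phi] after rescaling. *)
Lemma riesz E (phi : E -> K) (c : R) :
    (forall a x y, phi (a *: x + y) = a * phi x + phi y) ->
    (forall x, `|phi x| <= of_real c * `|x|) ->
  exists z, forall x, phi x = inner x z.
Proof.
move=> phiL phic.
have phi0 : phi 0 = 0.
  by have := phiL (-1) 0 0; rewrite scaler0 addr0 mulN1r addNr.
have phiB x y : phi (x - y) = phi x - phi y.
  by rewrite addrC -scaleN1r phiL mulN1r addrC.
have phiZ a x : phi (a *: x) = a * phi x.
  by rewrite -[a *: x]addr0 phiL phi0 addr0.
pose N := [set x | phi x = 0].
have Nsub : closed_subspace N.
  split => //= [a x y|x Nx].
    by rewrite /N /= phiL => -> ->; rewrite mulr0 addr0.
  (* Nothing makes [c] positive, so it is enlarged before dividing by it. A point of [N] within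
     [e / c1] of [x] then gives [|phi x| <= e]. *)
  pose c1 := Num.max c 1.
  have c10 : 0 < c1 by rewrite lt_max ltr01 orbT.
  have phic1 y : `|phi y| <= of_real c1 * `|y|.
    by apply: le_trans (phic y) _; rewrite ler_wpM2r// of_real_le le_max lexx.
  have c1K : 0 < of_real c1 :> K by rewrite -(of_real0 R k) of_real_lt.
  apply/eqP; rewrite -normr_le0; apply/ler_addgt0Pr => e e0; rewrite add0r.
  have [y [Ny xy]] := Nx _ (nbhsx_ballx x _ (divr_gt0 e0 c1K)).
  rewrite -[phi x]subr0 -Ny -phiB (le_trans (phic1 _))//.
  by move: xy; rewrite -ball_normE /= ltr_pdivlMr// mulrC => /ltW.
have [phi_0|/existsNP[x0 /eqP x00]] := pselect (forall x, phi x = 0).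
  by exists 0 => x; rewrite linear0r phi_0.
have [Np pP] := projP x0 Nsub.
move: (x0 - Defs.proj N x0) (phiB x0 (Defs.proj N x0)) pP => w.
rewrite [phi (Defs.proj _ _)]Np subr0 => phiw wP.
have w0 : w != 0 by apply: contra x00 => /eqP w0; rewrite -phiw w0 phi0.
have n0 : `|w| ^+ 2 != 0 :> K by rewrite sqrf_eq0 normr_eq0.
(* The conjugate compensates for conjugate-linearity in the second argument. The formula follows
   because [phi w *: x - phi x *: w] is in [N], hence orthogonal to [w]. *)
exists (sconj (phi w / `|w| ^+ 2) *: w) => x.
rewrite linearZr_LR /= sconjK.
have : inner w (phi w *: x - phi x *: w) = 0.
  by apply: wP; rewrite /N /= phiB !phiZ mulrC subrr.
rewrite inner_sym => /(congr1 sconj); rewrite sconjK (sconj_ge0 (lexx _)).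
rewrite linearBl !linearZl_LR /= inner_norm.
move=> /eqP; rewrite subr_eq0 => /eqP h.
by rewrite [RHS]mulrCA h mulrCA mulVf ?mulr1.
Qed.

(** By Cauchy-Schwarz, pairing [f] with [y] is a functional bounded by [c * rnorm y], so Riesz makes
    the set chosen from in [adjoint] nonempty. *)
Lemma adjointP E F (f : E -> F) (x : E) (y : F) : bounded_op f ->
  inner (f x) y = inner x (adjoint f y).
Proof.
move=> [fL [c fc]].
have [z zP] : exists z, forall x, inner (f x) y = inner x z.
  apply: (@riesz _ _ (c * rnorm y)) => [a u w|u].
    by rewrite fL linearDl linearZl_LR.
  apply: le_trans (cauchy_schwarz _ _) _.
  by rewrite of_realM rnormE mulrAC ler_wpM2r.
by apply: (@xgetPex _ 0 [set z | forall x, inner (f x) y = inner x z]); exists z.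
Qed.

Lemma adjoint_unique E F (f : E -> F) (y : F) (z : E) : bounded_op f ->
  (forall x, inner (f x) y = inner x z) -> adjoint f y = z.
Proof. by move=> fb zP; apply: inner_injr => x; rewrite -adjointP. Qed.

End HilbertSpace.

Section DirectSum.
Set Implicit Arguments.
Unset Strict Implicit.
Variables (R : realType) (k : scalar_kind).
Local Notation K := (Defs.scalar R k).
Implicit Types (H X Z Y : hilbertType R k).

(** * Norm, subspaces and operators on the direct sum *)

Lemma ler_norm_fst H X (p : hsum H X) : `|p.1| <= `|p| :> K.
Proof. by rewrite -ler_sqr ?nnegrE// hsum_normE lerDl exprn_ge0. Qed.

Lemma ler_norm_snd H X (p : hsum H X) : `|p.2| <= `|p| :> K.
Proof. by rewrite -ler_sqr ?nnegrE// hsum_normE lerDr exprn_ge0. Qed.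

Lemma ler_hsum_norm H X (p : hsum H X) : `|p| <= `|p.1| + `|p.2| :> K.
Proof.
rewrite -ler_sqr ?nnegrE ?addr_ge0// hsum_normE sqrrD addrAC lerDl.
by rewrite mulrn_wge0// mulr_ge0.
Qed.

(** The topology of [hsum] comes from its Hilbert norm, which the sum of the component norms
    dominates. *)
Lemma cvg_hsum H X (I : Type) (F : set_system I) (f : I -> hsum H X)
    (p : hsum H X) :
  Filter F -> (fst \o f : I -> H) @ F --> (p.1 : H) ->
  (snd \o f : I -> X) @ F --> (p.2 : X) ->
  f @ F --> p.
Proof.
move=> FF /cvgrPdist_lt f1 /cvgrPdist_lt f2; apply/cvgrPdist_lt => e e0.
have e20 : 0 < e / 2 by rewrite divr_gt0.
apply: filterS (filterI (f1 _ e20) (f2 _ e20)) => i [/= h1 h2].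
rewrite (splitr e); apply: le_lt_trans (ltrD h1 h2).
exact: (ler_hsum_norm (p - f i)).
Qed.

Lemma closed_subspace_subsum H X (W : set H) (V : set X) :
  closed_subspace W -> closed_subspace V -> closed_subspace (subsum W V).
Proof.
move=> [W0 WD Wcl] [V0 VD Vcl]; split => //.
  by move=> a [x1 x2] [y1 y2] /= [? ?] [? ?]; split; [exact: WD|exact: VD].
(* The coordinate maps do not increase norms, so each component of a point in the closure is in the
   closure of its own factor. *)
move=> p pcl; split.
  apply: Wcl => A /nbhs_ballP[e e0 eA].
  have [q [[Wq _] pq]] := pcl _ (nbhsx_ballx p _ e0).
  exists q.1; split => //; apply: eA; move: pq; rewrite -!ball_normE /=.
  by apply: le_lt_trans; exact: (ler_norm_fst (p - q)).
apply: Vcl => A /nbhs_ballP[e e0 eA].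
have [q [[_ Vq] pq]] := pcl _ (nbhsx_ballx p _ e0).
exists q.2; split => //; apply: eA; move: pq; rewrite -!ball_normE /=.
by apply: le_lt_trans; exact: (ler_norm_snd (p - q)).
Qed.

Lemma bounded_opsum H X Z Y (f : H -> Z) (g : X -> Y) :
  bounded_op f -> bounded_op g -> bounded_op (opsum f g).
Proof.
move=> [fL [c fc]] [gL [d gd]]; split.
  by move=> a [x1 x2] [y1 y2]; rewrite /opsum /= fL gL.
(* The bounds [c] and [d] may be negative. Absolute values are needed before a component norm is
   replaced by the larger [|p|]. *)
exists (`|c| + `|d|) => p; apply: le_trans (ler_hsum_norm _) _ => /=.
have bound (u : R) (r t : K) : 0 <= r -> r <= t ->
    of_real u * r <= of_real `|u| * t.
  move=> r0 rt; apply: (@le_trans _ _ (of_real `|u| * r)).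
    by rewrite ler_wpM2r// of_real_le ler_norm.
  by rewrite ler_wpM2l// -(of_real0 R k) of_real_le.
rewrite of_realD mulrDl lerD//.
  by apply: le_trans (fc _) _; rewrite bound ?ler_norm_fst.
by apply: le_trans (gd _) _; rewrite bound ?ler_norm_snd.
Qed.

Lemma invertible_opsum H X (f : H -> H) (g : X -> X) :
  invertible_op f -> invertible_op g -> invertible_op (opsum f g).
Proof.
move=> [fb [f' [f'b fK f'K]]] [gb [g' [g'b gK g'K]]].
split; first exact: bounded_opsum.
exists (opsum f' g'); split; first exact: bounded_opsum.
  by move=> [x y]; rewrite /opsum /= fK gK.
by move=> [x y]; rewrite /opsum /= f'K g'K.
Qed.

Lemma adjoint_opsum H X Z Y (f : H -> Z) (g : X -> Y) :
  bounded_op f -> bounded_op g ->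
  adjoint (opsum f g) = opsum (adjoint f) (adjoint g).
Proof.
move=> fb gb; apply/funext => q.
apply: adjoint_unique; first exact: bounded_opsum.
move=> p; rewrite !hsum_innerE /=.
by rewrite (adjointP _ _ fb) (adjointP _ _ gb).
Qed.

Lemma proj_subsum H X (W : set H) (V : set X) :
  closed_subspace W -> closed_subspace V ->
  Defs.proj (subsum W V) = opsum (Defs.proj W) (Defs.proj V).
Proof.
move=> Wsub Vsub; apply/funext => p.
have [Wp pW] := projP p.1 Wsub; have [Vp pV] := projP p.2 Vsub.
apply: proj_unique => //; first exact: closed_subspace_subsum.
by move=> z [Wz Vz]; rewrite hsum_innerE /= pW// pV// addr0.
Qed.

(** * Unconditional sums, additively and by components *)

Lemma partial_sumD (I : choiceType) (V : zmodType) (x y : I -> V) :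
  summability.partial_sum (fun i => x i + y i) =
  (fun A => summability.partial_sum x A + summability.partial_sum y A).
Proof. by apply/funext => A; exact: big_split. Qed.

Lemma sums_toD (L : numFieldType) (V : normedModType L) (I : choiceType)
    (x y : I -> V) s t :
  sums_to x s -> sums_to y t -> sums_to (fun i => x i + y i) (s + t).
Proof.
move=> xs yt; rewrite /sums_to partial_sumD.
exact: (@cvgD _ _ _ _ (@summability.totally_filter I) _ _ _ _ xs yt).
Qed.

(** Normed modules are Hausdorff. This makes a frame operator unique as a function. *)
Lemma sums_to_unique (L : numFieldType) (V : normedModType L) (I : choiceType)
    (x : I -> V) s t : sums_to x s -> sums_to x t -> s = t.
Proof.
move=> xs xt; have FF := @summability.totally_filter I.
by apply: (cvg_unique _ xs xt); exact: norm_hausdorff.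
Qed.

Lemma sums_to_hsum H X (I : choiceType) (x : I -> H) (y : I -> X) s t :
  sums_to x s -> sums_to y t ->
  sums_to (fun i => (x i, y i) : hsum H X) (s, t).
Proof.
have psE A : summability.partial_sum (fun i => (x i, y i) : hsum H X) A =
    (summability.partial_sum x A, summability.partial_sum y A).
  rewrite /summability.partial_sum.
  (* One induction runs through the three finite sums together, keeping the third equal to the pair
     of the first two. *)
  by apply: (big_rec3 (fun a b c => c = (a, b))) => // i a b c _ ->.
move=> xs yt; apply: (@cvg_hsum _ _ _ _ _ _ (@summability.totally_filter I)).
  rewrite (_ : fst \o _ = summability.partial_sum x)//.
  by apply/funext => A /=; rewrite psE.
rewrite (_ : snd \o _ = summability.partial_sum y)//.
by apply/funext => A /=; rewrite psE.
Qed.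

End DirectSum.

Theorem theorem3p7
  (R : realType) (k : scalar_kind)
  (H X : hilbertType R k) (sepH : separable H) (sepX : separable X)
  (J : set int) (Hj Xj : J -> hilbertType R k)
  (W : J -> set H) (V : J -> set X) (v : J -> R)
  (Lambda : forall j : J, H -> Hj j) (Gamma : forall j : J, X -> Xj j)
  (W_closed : forall j : J, closed_subspace (W j))
  (V_closed : forall j : J, closed_subspace (V j))
  (v_gt0 : forall j : J, 0 < v j)
  (Lambda_bounded : forall j : J, bounded_op (Lambda j))
  (Gamma_bounded : forall j : J, bounded_op (Gamma j))
  (K1 : H -> H) (K2 : X -> X) (T T1 : H -> H) (U U1 : X -> X)
  (K1_bounded : bounded_op K1) (K2_bounded : bounded_op K2)
  (T_inv : invertible_op T) (T1_inv : invertible_op T1)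
  (U_inv : invertible_op U) (U1_inv : invertible_op U1)
  (A B C D : R)
  (frame_Lambda : controlled_gfusion_frame W Lambda v T T1 K1 A B)
  (frame_Gamma : controlled_gfusion_frame V Gamma v U U1 K2 C D) :
  controlled_gfusion_frame
    (fun j : J => subsum (W j) (V j))
    (fun j : J => opsum (Lambda j) (Gamma j)) v
    (opsum T U) (opsum T1 U1) (opsum K1 K2)
    (Num.min A C) (Num.max B D) /\
  (forall (SC : H -> H) (SC' : X -> X),
    is_frame_operator W Lambda v T T1 SC ->
    is_frame_operator V Gamma v U U1 SC' ->
    is_frame_operator
      (fun j : J => subsum (W j) (V j))
      (fun j : J => opsum (Lambda j) (Gamma j)) v
      (opsum T U) (opsum T1 U1) (opsum SC SC') /\
    forall S : hsum H X -> hsum H X,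
      is_frame_operator
        (fun j : J => subsum (W j) (V j))
        (fun j : J => opsum (Lambda j) (Gamma j)) v
        (opsum T U) (opsum T1 U1) S ->
      S = opsum SC SC').
Proof.
move: frame_Lambda frame_Gamma.
move=> [_ _ _ /andP[A0 AB] sL] [_ _ _ /andP[C0 CD] sG].
have [Tb _] := T_inv; have [Ub _] := U_inv.
split.
  split.
  - by split; apply: invertible_opsum.
  - exact: bounded_opsum.
  - move=> j; split => //; first exact: closed_subspace_subsum.
    exact: bounded_opsum.
  - by rewrite lt_min A0 C0 /= ge_min le_max AB.
  move=> e; have [s [sumL Ls sB]] := sL e.1; have [t [sumG Gt tD]] := sG e.2.
  (* Projections, operators and inner product all act by components, so each term of the new series
     is the sum of the two old terms. *)
  exists (s + t); split.
  - have := sums_toD sumL sumG; congr (sums_to _ _); apply/funext => j.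
    by rewrite proj_subsum// -mulrDr.
  (* The squared norm of the adjoint's value splits in two. The minimum lies below [A] on one part
     and below [C] on the other. *)
  - rewrite adjoint_opsum// hsum_normE mulrDr lerD//=.
      by apply: le_trans Ls; rewrite ler_wpM2r ?exprn_ge0// of_real_le ge_min lexx.
    by apply: le_trans Gt; rewrite ler_wpM2r ?exprn_ge0// of_real_le ge_min lexx orbT.
  - rewrite hsum_normE mulrDr lerD//.
      by apply: (le_trans sB); rewrite ler_wpM2r ?exprn_ge0// of_real_le le_max lexx.
    by apply: (le_trans tD); rewrite ler_wpM2r ?exprn_ge0// of_real_le le_max lexx orbT.
move=> SC SC' SCP SC'P.
have sumE : is_frame_operator (fun j : J => subsum (W j) (V j))
    (fun j : J => opsum (Lambda j) (Gamma j)) v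
    (opsum T U) (opsum T1 U1) (opsum SC SC').
  move=> e; have := sums_to_hsum (SCP e.1) (SC'P e.2).
  congr (sums_to _ _); apply/funext => j.
  by rewrite proj_subsum// !adjoint_opsum.
(* Any other frame operator sums the same series at each [e], so it agrees there with the
   componentwise one. *)
by split=> // S SP; apply/funext => e; apply: sums_to_unique (SP e) (sumE e).
Qed.
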